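(* Let $F\subset\mathbb{R}^n$ be a fractal curve, let $\varphi_1,\varphi_2\in F$ with $\varphi_1<\varphi_2$, let $A=\{\theta\in F:\varphi_1<\theta<\varphi_2\}$, and let $p,g:A\to\mathbb{R}$ be $F$-continuous. Consider the $\alpha$-order linear fractal differential equation $$D_F^{\alpha}y(\theta)+p(\theta)\,y(\theta)=g(\theta),\qquad \theta\in A .$$ Then there exists an $F^{\alpha}$-differentiable, nowhere vanishing function $\mu:A\to\mathbb{R}$ (called an integration factor) such that all the solutions $y:A\to\mathbb{R}$ of this equation are given by $$y(\theta)=\frac{\displaystyle\int \mu(\theta)\,g(\theta)\,d_F^{\alpha}\theta+c}{\mu(\theta)},\qquad \theta\in A,$$ where $c\in\mathbb{R}$ is an arbitrary constant.
   Context: Fractal curve: a set $F\subset\mathbb{R}^n$ with a continuous bijective parametrization $\mathbf{w}:[a_0,b_0]\to F$. Points of $F$ are ordered by parameter: $\theta<\theta'$ means $\mathbf{w}^{-1}(\theta)<\mathbf{w}^{-1}(\theta')$. For $a\le b$, $C(a,b)$ is the segment of $F$ between $\mathbf{w}(a)$ and $\mathbf{w}(b)$; we also write $C(\theta_0,\theta)$ for the segment between points $\theta_0,\theta\in F$. Mass function: fix $1\le\alpha\le n$. For $[a,b]\subset[a_0,b_0]$, $$\gamma^{\alpha}(F,a,b)=\lim_{\delta\to0}\ \inf_{|P|\le\delta}\ \sum_{i=0}^{m-1}\frac{|\mathbf{w}(t_{i+1})-\mathbf{w}(t_i)|^{\alpha}}{\Gamma(\alpha+1)},$$ the infimum being over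 subdivisions $P=\{a=t_0<\dots<t_m=b\}$ with $|P|=\max_i(t_{i+1}-t_i)\le\delta$, and $|\cdot|$ the Euclidean norm. Staircase function: fix $p_0\in[a_0,b_0]$; $S_F^{\alpha}(u)=\gamma^{\alpha}(F,p_0,u)$ if $u\ge p_0$ and $S_F^{\alpha}(u)=-\gamma^{\alpha}(F,u,p_0)$ if $u<p_0$. Put $J(\theta)=S_F^{\alpha}(\mathbf{w}^{-1}(\theta))$ for $\theta\in F$. Standing convention: $S_F^{\alpha}$ is finite and strictly increasing on $[a_0,b_0]$, so that the difference quotients below make sense. $F$-limit and $F$-continuity: $F\text{-}\lim_{\theta'\to\theta}f(\theta')=\ell$ means that for every $\varepsilon>0$ there is $\delta>0$ such that $|f(\theta')-\ell|<\varepsilon$ for all $\theta'$ in the domain of $f$ (a subset of $F$) with $0<|\theta'-\theta|<\delta$; $f$ is $F$-continuous if $F\text{-}\lim_{\theta'\to\theta}f(\theta')=f(\theta)$ at each point $\theta$ of its domain. $F^{\alpha}$-derivative: $D_F^{\alpha}f(\theta)=F\text{-}\lim_{\theta'\to\theta}\dfrac{f(\theta')-f(\theta)}{J(\theta')-J(\theta)}$ if this limit exists; $f$ is $F^{\alpha}$-differentiable if it exists at every point of its domain. $F^{\alpha}$-integral: for $f$ bounded on $C(a,b)$, $$\int_{C(a,b)}f\,d_F^{\alpha}\theta=\sup_{P}\sum_i\Big(\inf_{C(t_i,t_{i+1})}f\Big)\big(J(\theta_{i+1})-J(\theta_i)\big)=\inf_{P}\sum_i\Big(\sup_{C(t_i,t_{i+1})}f\Big)\big(J(\theta_{i+1})-J(\theta_i)\big),$$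 where $P$ ranges over subdivisions $\{t_i\}$ of $[a,b]$, $\theta_i=\mathbf{w}(t_i)$, and the integral is defined when the two values agree. The integral over $C(\theta_0,\theta)$ changes sign when $\theta<\theta_0$. The indefinite integral $\int h(\theta)\,d_F^{\alpha}\theta$ of an $F$-continuous function $h$ on $A$ denotes a fixed $F^\alpha$-primitive of $h$, e.g. $\theta\mapsto\int_{C(\theta_*,\theta)}h\,d_F^{\alpha}\tau$ for a fixed base point $\theta_*\in A$. A solution of the equation is a function $y:A\to\mathbb{R}$ that has an $F^{\alpha}$-derivative at each point of $A$ and satisfies the equation at each point of $A$. *)

(* Defs.v *)
From mathcomp Require Import all_boot all_order all_algebra.
From mathcomp Require Import all_classical all_reals all_analysis.
Set Implicit Arguments.
Unset Strict Implicit.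
Unset Printing Implicit Defensive.
Import Order.TTheory GRing.Theory Num.Theory.
Import numFieldNormedType.Exports.
Local Open Scope classical_set_scope.
Local Open Scope ring_scope.

(* A function on a subset D of the curve is represented by a total function
   on 'rV[R]_n; limits, continuity, derivatives, primitives and solutions take
   D as an argument and only depend on the values on D. *)

(* The norm that the library puts on row vectors is the sup norm. *)
Definition enorm (R : realType) (n : nat) (x : 'rV[R]_n) : R :=
  Num.sqrt (\sum_i x ord0 i ^+ 2).

Definition Gamma (R : realType) (s : R) : R :=
  Rintegral (@lebesgue_measure R) `[0, +oo[%classic
    (fun t => t `^ (s - 1) * expR (- t)).

Section FractalCurve.
Context {R : realType} {n : nat}.
Implicit Types (F D : set 'rV[R]_n) (w : R -> 'rV[R]_n) (s : seq R).
Implicit Types (J f h y : 'rV[R]_n -> R) (theta : 'rV[R]_n).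

Definition is_fractal_curve F w (a0 b0 : R) : Prop :=
  {within `[a0, b0], continuous w} /\ set_bij `[a0, b0] F w.

Definition param w (a0 b0 : R) : 'rV[R]_n -> R := pinv `[a0, b0] w.

Definition curve_lt w (a0 b0 : R) theta theta' : Prop :=
  param w a0 b0 theta < param w a0 b0 theta'.

Definition segment w (a b : R) : set 'rV[R]_n := w @` `[a, b].

(* As in itv_partition, the subdivision a = t_0 < ... < t_m = b is given by
   the list s of t_1, ..., t_m, so that t_i = nth b (a :: s) i; for a = b the
   only subdivision is s = [::], with m = 0. *)
Definition mesh (a b : R) s : R :=
  \big[Num.max/0]_(0 <= i < size s)
    (nth b (a :: s) i.+1 - nth b (a :: s) i).

Definition mass_sum w (alpha a b : R) s : R :=
  \sum_(0 <= i < size s)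
    enorm (w (nth b (a :: s) i.+1) - w (nth b (a :: s) i)) `^ alpha
      / Gamma (alpha + 1).

Definition coarse_mass w (alpha a b delta : R) : \bar R :=
  ereal_inf [set (mass_sum w alpha a b s)%:E | s in
              [set s | itv_partition a b s /\ mesh a b s <= delta]].

Definition mass w (alpha a b : R) : \bar R :=
  lim (coarse_mass w alpha a b delta @[delta --> 0^'+]).

Definition staircase w (alpha p0 u : R) : \bar R :=
  if p0 <= u then mass w alpha p0 u else (- mass w alpha u p0)%E.

Definition regular_staircase w (a0 b0 alpha p0 : R) : Prop :=
  (forall u, u \in `[a0, b0] -> staircase w alpha p0 u \is a fin_num) /\
  (forall u v, u \in `[a0, b0] -> v \in `[a0, b0] -> u < v ->
     (staircase w alpha p0 u < staircase w alpha p0 v)%E).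

Definition curve_staircase w (a0 b0 alpha p0 : R) theta : R :=
  fine (staircase w alpha p0 (param w a0 b0 theta)).

Definition F_limit D f theta (l : R) : Prop :=
  forall eps : R, 0 < eps -> exists2 delta : R, 0 < delta &
    forall theta', D theta' -> 0 < enorm (theta' - theta) < delta ->
      `|f theta' - l| < eps.

Definition F_continuous D f : Prop :=
  forall theta, D theta -> F_limit D f theta (f theta).

Definition is_F_derivative J D f theta (l : R) : Prop :=
  F_limit D (fun theta' => (f theta' - f theta) / (J theta' - J theta))
    theta l.

Definition F_differentiable J D f : Prop :=
  forall theta, D theta -> exists l, is_F_derivative J D f theta l.

Definition F_primitive J D h f : Prop :=
  forall theta, D theta -> is_F_derivative J D f theta (h theta).

Definition lower_sum J w f (a b : R) s : R :=
  let t := nth b (a :: s) in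
  \sum_(0 <= i < size s)
    inf (f @` segment w (t i) (t i.+1)) * (J (w (t i.+1)) - J (w (t i))).

Definition upper_sum J w f (a b : R) s : R :=
  let t := nth b (a :: s) in
  \sum_(0 <= i < size s)
    sup (f @` segment w (t i) (t i.+1)) * (J (w (t i.+1)) - J (w (t i))).

Definition lower_integral J w f (a b : R) : R :=
  sup [set lower_sum J w f a b s | s in itv_partition a b].

Definition upper_integral J w f (a b : R) : R :=
  inf [set upper_sum J w f a b s | s in itv_partition a b].

(* The integral over C(a, b), for a <= b, is the common value; the real sup
   and inf above are meaningful because f is required to be bounded. *)
Definition F_integrable J w f (a b : R) : Prop :=
  [bounded f theta | theta in segment w a b] /\
  lower_integral J w f a b = upper_integral J w f a b.

Definition oriented_integrable J w (a0 b0 : R) f theta0 theta : Prop :=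
  F_integrable J w f
    (Num.min (param w a0 b0 theta0) (param w a0 b0 theta))
    (Num.max (param w a0 b0 theta0) (param w a0 b0 theta)).

Definition oriented_integral J w (a0 b0 : R) f theta0 theta : R :=
  let u0 := param w a0 b0 theta0 in let u := param w a0 b0 theta in
  if u0 <= u then lower_integral J w f u0 u
  else - lower_integral J w f u u0.

Definition is_solution J D (p g : 'rV[R]_n -> R) y : Prop :=
  forall theta, D theta -> exists2 dy : R,
    is_F_derivative J D y theta dy & dy + p theta * y theta = g theta.

End FractalCurve.

(* Main.v *)
Require Import Defs.
From mathcomp Require Import all_boot all_order all_algebra.
From mathcomp Require Import all_classical all_reals all_analysis.
From mathcomp Require Import ring lra.
Set Implicit Arguments.
Unset Strict Implicit.
Unset Printing Implicit Defensive.
Import Order.TTheory GRing.Theory Num.Theory.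
Import numFieldNormedType.Exports.
Local Open Scope classical_set_scope.
Local Open Scope ring_scope.

(** The parametrization [w] is a homeomorphism from the parameter segment onto
    the curve, because a continuous bijection from a compact segment has a
    continuous inverse ([curve_inverse_continuous]).  Hence limits along the
    curve are limits in the parameter [t] ([F_limit_param]), and with
    [S = J \o w] the fractal derivative becomes the limit of
    [(h x - h t) / (S x - S t)], the derivative with respect to the strictly
    increasing function [S].

    The usual calculus holds for this derivative once [S] is continuous.  The
    coarse mass is subadditive, the mass is superadditive, and they are close
    when the mesh is small; comparing a nearly optimal subdivision with one
    that contains a prescribed short step bounds the increment of the mass over
    that step by the cost of the step, up to an arbitrarily small error
    ([cost_continuity]).  The cost of a step tends to zero with its length since
    [1 <= alpha], so the staircase has no jump ([fine_staircase_continuous]).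

    Both the lower and the upper integral of a continuous function are additive
    functions of the segment that satisfy the mean value bounds
    ([darboux_stieltjes]).  These two properties determine the value
    ([stieltjes_integral_unique]), whence integrability, and give the
    fundamental theorem of calculus ([signed_integral_primitive]).  The
    uniqueness and the fact that a function whose derivative vanishes is
    constant rest on one compactness argument ([segment_local_global],
    [additive_locally_small_eq0]).

    It remains to solve the linear equation as usual: with [P] a primitive of
    [p] and [mu = expR P], the equation says that [mu * y] is a primitive of
    [mu * g] ([linear_equation_solutions]). *)

(** * Subdivisions and compactness of a segment *)

Section ChainSums.
Context {R : realType}.
Implicit Types (a b c d e u v : R) (s : seq R) (r : rel R).
Implicit Types (phi psi : R -> R -> R).

Fixpoint chain_sum phi a s : R :=
  if s is x :: s' then phi a x + chain_sum phi x s' else 0.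

(** Lower, upper and mass sums are all of this form; the recursive version
    does away with the default value of [nth]. *)
Lemma chain_sumE phi a b s :
  \sum_(0 <= i < size s) phi (nth b (a :: s) i) (nth b (a :: s) i.+1)
  = chain_sum phi a s.
Proof.
elim: s a => [|x s ih] a; first by rewrite big_nil.
by rewrite big_nat_recl//= -ih.
Qed.

Lemma chain_sum_cat phi a s1 s2 :
  chain_sum phi a (s1 ++ s2)
  = chain_sum phi a s1 + chain_sum phi (last a s1) s2.
Proof. by elim: s1 a => [|x s1 ih] a /=; rewrite ?add0r// ih addrA. Qed.

Lemma chain_sum_telescope k (S : R -> R) a s :
  chain_sum (fun u v => k * (S v - S u)) a s = k * (S (last a s) - S a).
Proof. by elim: s a => [|x s ih] a /=; rewrite ?ih; ring. Qed.

Lemma path_lt_last a s : path <%R a s -> a <= last a s.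
Proof.
elim: s a => //= x s ih a /andP[ax xs].
by rewrite (le_trans (ltW ax))// ih.
Qed.

Lemma chain_sum_le phi psi a s : path <%R a s ->
  (forall u v, a <= u -> u < v -> v <= last a s -> phi u v <= psi u v) ->
  chain_sum phi a s <= chain_sum psi a s.
Proof.
elim: s a => //= x s ih a /andP[ax xs] phipsi.
apply: lerD; first by apply: phipsi => //; exact: path_lt_last.
by apply: ih => // u v xu; apply: phipsi; rewrite (le_trans (ltW ax)).
Qed.

(** The only step of the subdivision that changes when [c] is inserted is the
    one that contains [c], whence a single error term [e].  The relation [r]
    is [<] for Darboux sums, and also bounds the mesh for mass sums. *)
Lemma chain_split r phi e a b c s :
  (forall u v, r u v -> u < v) ->
  (forall u v, u < c < v -> r u v -> r u c && r c v) ->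
  0 <= e ->
  (forall u v, a <= u -> v <= b -> u < c < v -> r u v ->
     phi u c + phi c v <= phi u v + e) ->
  a < c < b -> path r a s -> last a s = b ->
  exists s1 s2, [/\ path r a s1 /\ last a s1 = c,
    path r c s2 /\ last c s2 = b &
    chain_sum phi a s1 + chain_sum phi c s2 <= chain_sum phi a s + e].
Proof.
move=> rlt rc e0 phie; elim: s a phie => [|x s ih] a phie /andP[ac cb] /=.
  by move=> _ ab; move: ac cb; rewrite ab => /lt_trans /[apply]; rewrite ltxx.
move=> /andP[ax xs] xb.
have xleb : x <= b.
  by rewrite -xb; apply: path_lt_last; apply: sub_path xs => u v; exact: rlt.
have [xc|cx|xc] := ltgtP x c.
- have [||s1 [s2 [[xs1 s1c] s2P sumle]]] := ih x _ _ xs xb.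
  + by move=> u v xu; apply: phie; rewrite (le_trans _ xu)// ltW// rlt.
  + by rewrite xc.
  + exists (x :: s1), s2; split => //=; first by rewrite ax.
    by rewrite -!addrA lerD2l.
- have /andP[rac rcx] := rc a x (introT andP (conj ac cx)) ax.
  exists [:: c], (x :: s); split => //=.
  + by rewrite rac.
  + by rewrite rcx.
  + by have := phie a x (lexx _) xleb (introT andP (conj ac cx)) ax; lra.
- subst x; exists [:: c], s; split => //=; first by rewrite ax.
  by rewrite addr0 lerDl.
Qed.

(** This is the compactness of a segment in the form in which it is used
    throughout: a property of segments that is stable under concatenation
    holds for a segment as soon as it holds near each of its points. *)
Lemma segment_local_global (G : R -> R -> Prop) a b :
  (forall u c v, a <= u -> u <= c -> c <= v -> v <= b ->
     G u c -> G c v -> G u v) ->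
  (forall t, a <= t <= b -> exists2 d, 0 < d &
     forall u v, a <= u -> u <= t -> t <= v -> v <= b -> v - u < d -> G u v) ->
  a <= b -> G a b.
Proof.
move=> Gcat Gloc ab.
pose E := [set x | a <= x <= b /\ G a x].
have Ea : E a.
  have [|d d0 Gd] := Gloc a; first by rewrite lexx ab.
  by split; [rewrite lexx ab|apply: Gd; rewrite ?lexx// subrr].
have bE : ubound E b by move=> x [/andP[]].
have supE : has_sup E by split; [exists a|exists b].
(* The supremum of the right ends reached from [a] is reached, and is [b]. *)
have ac : a <= sup E by apply: ub_le_sup => //; exists b.
have cb : sup E <= b by apply: ge_sup => //; exists a.
have [|d d0 Gd] := Gloc (sup E); first by rewrite ac cb.
have [x Ex cx] := sup_adherent (divr_gt0 d0 (ltr0n _ 2)) supE.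
have xc : x <= sup E by apply: ub_le_sup => //; exists b.
have [/andP[ax xb] Gax] := Ex.
have Gav v : sup E <= v -> v <= b -> v - sup E < d / 2 -> G a v.
  move=> cv vb vc; apply: (Gcat a x) => //; first exact: le_trans cv.
  by apply: Gd => //; lra.
have [bc|cltb] := leP b (sup E).
  by apply: Gav => //; lra.
pose v := Num.min b (sup E + d / 4).
have vb : v <= b by rewrite ge_min lexx.
have vcd : v <= sup E + d / 4 by rewrite ge_min lexx orbT.
have cv : sup E < v by rewrite lt_min cltb/= ltrDl divr_gt0.
have Ev : E v.
  split; first by rewrite vb (le_trans ac (ltW cv)).
  by apply: Gav => //; [exact: ltW|lra].
have : v <= sup E by apply: ub_le_sup => //; exists b.
by rewrite leNgt cv.
Qed.

End ChainSums.

(** * The Darboux-Stieltjes integral of a continuous function *)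

Section Darboux.
Context {R : realType}.
Implicit Types (a b c d e u v t lo hi m M : R) (s : seq R).
Implicit Types (S h : R -> R) (L : R -> R -> R).

(** The common core of the uniqueness of the integral and of the constancy of
    functions whose derivative vanishes: an additive function of segments that
    is locally [o(dS)] is zero.  Compactness makes the local bound
    [e * (S v - S u)] global, and then [e] tends to zero. *)
Lemma additive_locally_small_eq0 S L a b :
  (forall u c v, a <= u -> u <= c -> c <= v -> v <= b ->
     L u v = L u c + L c v) ->
  (forall e, 0 < e -> forall t, a <= t <= b -> exists2 d, 0 < d &
     forall u v, a <= u -> u <= t -> t <= v -> v <= b -> v - u < d ->
     `|L u v| <= e * (S v - S u)) ->
  a <= b -> L a b = 0.
Proof.
move=> Ladd Lloc ab.
have small e : 0 < e -> `|L a b| <= e * (S b - S a).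
  move=> e0; pose G u v := `|L u v| <= e * (S v - S u).
  apply: (@segment_local_global R G) => //; last exact: Lloc.
  move=> u c v au uc cv vb; rewrite /G => Guc Gcv.
  rewrite (Ladd u c v)// (le_trans (ler_normD _ _))//.
  by rewrite (le_trans (lerD Guc Gcv))// -mulrDr addrC subrKA.
have S0 : 0 <= S b - S a.
  by rewrite -(mul1r (S b - S a)) (le_trans _ (small 1 ltr01)).
apply/eqP; apply: contraTT isT => L0.
have Lgt0 : 0 < `|L a b| by rewrite normr_gt0.
have [S00|Spos] := leP (S b - S a) 0.
  by have := small 1 ltr01; rewrite mul1r leNgt (le_lt_trans S00).
have := small (`|L a b| / (S b - S a) / 2).
rewrite !divr_gt0// => /(_ isT).
have -> : `|L a b| / (S b - S a) / 2 * (S b - S a) = `|L a b| / 2.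
  by field; rewrite gt_eqF.
by move=> H; have : False by lra.
Qed.

(** Additivity and the mean value bounds are all that is used of an integral:
    they determine its value and make it a primitive. *)
Definition stieltjes_integral S h lo hi L : Prop :=
  (forall a c b, lo < a -> a <= c -> c <= b -> b < hi ->
     L a b = L a c + L c b) /\
  (forall a b m M, lo < a -> a <= b -> b < hi ->
     (forall t, a <= t <= b -> m <= h t <= M) ->
     m * (S b - S a) <= L a b <= M * (S b - S a)).

Lemma continuous_near h t e : {for t, continuous h} -> 0 < e ->
  exists2 d, 0 < d & forall x, `|x - t| < d -> h t - e <= h x <= h t + e.
Proof.
move=> /cvgrPdist_le /(_ e) + e0 => /(_ e0) /nbhs_ballP [d /= d0 dh].
exists d => // x xt; have : `|h t - h x| <= e.
  by apply: dh; rewrite /ball/= distrC.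
by rewrite ler_norml; lra.
Qed.

Lemma stieltjes_integral_unique S h lo hi L1 L2 a b :
  (forall t, lo < t < hi -> {for t, continuous h}) ->
  stieltjes_integral S h lo hi L1 -> stieltjes_integral S h lo hi L2 ->
  lo < a -> a <= b -> b < hi -> L1 a b = L2 a b.
Proof.
move=> hc [add1 bd1] [add2 bd2] loa ab bhi; apply/eqP; rewrite -subr_eq0.
apply/eqP.
apply: (@additive_locally_small_eq0 S (fun u v => L1 u v - L2 u v)) => //.
  move=> u c v au uc cv vb.
  have lou := lt_le_trans loa au; have vhi := le_lt_trans vb bhi.
  by rewrite (add1 u c v)// (add2 u c v)//; ring.
move=> e e0 t /andP[at_ tb].
have thi : lo < t < hi by rewrite (lt_le_trans loa at_) (le_lt_trans tb bhi).
have [d d0 dh] := continuous_near (hc t thi) (divr_gt0 e0 (ltr0n _ 2)).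
exists d => // u v au ut tv vb uvd.
have lou := lt_le_trans loa au; have vhi := le_lt_trans vb bhi.
have hb x : u <= x <= v -> h t - e / 2 <= h x <= h t + e / 2.
  by move=> uxv; apply: dh; rewrite ltr_norml; lra.
have := bd1 u v _ _ lou (le_trans ut tv) vhi hb.
have := bd2 u v _ _ lou (le_trans ut tv) vhi hb.
rewrite !mulrDl mulNr ler_norml.
have -> : e * (S v - S u) = e / 2 * (S v - S u) + e / 2 * (S v - S u) by field.
by lra.
Qed.

Lemma continuous_segment_bounded h a b :
  (forall t, a <= t <= b -> {for t, continuous h}) -> a <= b ->
  exists M, forall t, a <= t <= b -> `|h t| <= M.
Proof.
move=> hc ab.
pose G u v := exists M, forall t, u <= t <= v -> `|h t| <= M.
apply: (@segment_local_global R G) => //.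
  move=> u c v _ uc cv _ [M1 M1h] [M2 M2h]; exists (Num.max M1 M2) => t.
  move=> /andP[ut tv]; rewrite le_max.
  have [tc|ct] := leP t c; first by rewrite M1h ?ut.
  by rewrite M2h ?orbT// (ltW ct).
move=> t tab; have [d d0 dh] := continuous_near (hc t tab) ltr01.
exists d => // u v _ ut tv _ uvd; exists (`|h t| + 1) => x uxv.
have := dh x; rewrite ltr_norml => /(_ _)/andP.
case; first lra.
move=> h1 h2; have := ler_norm (h t); have := ler_norm (- h t).
by rewrite normrN ler_norml; lra.
Qed.

Definition step_inf S h u v := inf (h @` `[u, v]) * (S v - S u).

Definition darboux S h a b : R :=
  sup [set chain_sum (step_inf S h) a s | s in itv_partition a b].

Lemma inf_segment_bounds h u v m M : u <= v ->
  (forall t, u <= t <= v -> m <= h t <= M) -> m <= inf (h @` `[u, v]) <= M.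
Proof.
move=> uv hb; apply/andP; split.
  apply: lb_le_inf; first by exists (h u), u => //=; rewrite in_itv/= lexx.
  by move=> _ [t/= tuv <-]; move: tuv; rewrite in_itv/= => /hb /andP[].
apply: (@le_trans _ _ (h u)); last first.
  by have := hb u; rewrite lexx uv => /(_ isT)/andP[].
apply: ge_inf; last by exists u => //=; rewrite in_itv/= lexx.
by exists m => _ [t/= tuv <-]; move: tuv; rewrite in_itv/= => /hb /andP[].
Qed.

Lemma inf_segment_le h u v u' v' m : u <= u' -> u' <= v' -> v' <= v ->
  (forall t, u <= t <= v -> m <= h t) ->
  inf (h @` `[u, v]) <= inf (h @` `[u', v']).
Proof.
move=> uu uv vv hb; apply: lb_le_inf.
  by exists (h u'), u' => //=; rewrite in_itv/= lexx.
move=> _ [t/= + <-]; rewrite in_itv/= => /andP[ut tv].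
apply: ge_inf.
  by exists m => _ [x/= xuv <-]; move: xuv; rewrite in_itv/= => /hb.
by exists t => //=; rewrite in_itv/= (le_trans uu)// (le_trans tv).
Qed.

Section Fixed.
Variables (S h : R -> R) (lo hi : R).
Hypothesis S_mono : forall u v, lo < u -> u <= v -> v < hi -> S u <= S v.
Hypothesis h_cont : forall t, lo < t < hi -> {for t, continuous h}.

Lemma chain_sum_step_inf_bounds a b m M s : lo < a -> b < hi ->
  (forall t, a <= t <= b -> m <= h t <= M) -> itv_partition a b s ->
  m * (S b - S a) <= chain_sum (step_inf S h) a s <= M * (S b - S a).
Proof.
move=> loa bhi hb [sP /eqP sb].
rewrite -sb -!chain_sum_telescope.
have bd u v : a <= u -> u < v -> v <= last a s ->
    m <= inf (h @` `[u, v]) <= M /\ 0 <= S v - S u.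
  rewrite sb => au uv vb; split.
    apply: inf_segment_bounds => [|t /andP[ut tv]]; first exact: ltW.
    by apply: hb; rewrite (le_trans au)//= (le_trans tv).
  by rewrite subr_ge0 S_mono ?(ltW uv)// (lt_le_trans loa, le_lt_trans vb).
by apply/andP; split; apply: chain_sum_le => // u v au uv vs;
  have [/andP[mi iM] S0] := bd u v au uv vs; rewrite ler_wpM2r.
Qed.

Lemma has_sup_darboux a b : lo < a -> a < b -> b < hi ->
  has_sup [set chain_sum (step_inf S h) a s | s in itv_partition a b].
Proof.
move=> loa ab bhi; split.
  exists (chain_sum (step_inf S h) a [:: b]), [:: b] => //.
  exact: itv_partition1.
have [M Mh] : exists M, forall t, a <= t <= b -> `|h t| <= M.
  apply: continuous_segment_bounded (ltW ab) => t /andP[at_ tb].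
  by apply: h_cont; rewrite (lt_le_trans loa)//= (le_lt_trans tb).
exists (M * (S b - S a)) => _ [s sP <-].
have hb t : a <= t <= b -> - M <= h t <= M by move=> /Mh; rewrite ler_norml.
by have /andP[] := chain_sum_step_inf_bounds loa bhi hb sP.
Qed.

Lemma darboux_xx a : darboux S h a a = 0.
Proof.
rewrite /darboux (_ : [set _ | _ in _] = [set 0]) ?sup1//.
apply/seteqP; split => [_ [s /itv_partitionxx -> <-]//|_ ->].
by exists [::].
Qed.

Lemma darboux_catE a c b : lo < a -> a < c -> c < b -> b < hi ->
  darboux S h a b = darboux S h a c + darboux S h c b.
Proof.
move=> loa ac cb bhi.
have ab := lt_trans ac cb.
have loc := lt_trans loa ac; have chi := lt_trans cb bhi.
have [ne_ab ub_ab] := has_sup_darboux loa ab bhi.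
have [ne_ac ub_ac] := has_sup_darboux loa ac chi.
have [ne_cb ub_cb] := has_sup_darboux loc cb bhi.
have [M Mh] : exists M, forall t, a <= t <= b -> `|h t| <= M.
  apply: continuous_segment_bounded (ltW ab) => t /andP[at_ tb].
  by apply: h_cont; rewrite (lt_le_trans loa)//= (le_lt_trans tb).
apply/eqP; rewrite eq_le; apply/andP; split.
  apply: ge_sup => // _ [s [sP /eqP sb] <-].
  (* [chain_split] bounds the refined sum from above, hence the signs. *)
  have step u v : a <= u -> v <= b -> u < c < v -> u < v ->
      - step_inf S h u c + - step_inf S h c v <= - step_inf S h u v + 0.
    move=> au vb /andP[uc cv] uv.
    have mh t : u <= t <= v -> - M <= h t.
      move=> /andP[ut tv].
      have := Mh t; rewrite ler_norml (le_trans au)// (le_trans tv)//.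
      by move=> /(_ isT)/andP[].
    have i1 := inf_segment_le (lexx u) (ltW uc) (ltW cv) mh.
    have i2 := inf_segment_le (ltW uc) (ltW cv) (lexx v) mh.
    have lou := lt_le_trans loa au; have vhi := le_lt_trans vb bhi.
    have S1 : 0 <= S c - S u by rewrite subr_ge0 S_mono// ltW.
    have S2 : 0 <= S v - S c by rewrite subr_ge0 S_mono// ltW.
    rewrite /step_inf; set x := inf _; set y := inf _; set z := inf _.
    have := ler_wpM2r S1 i1; have := ler_wpM2r S2 i2.
    by rewrite -/x -/y -/z; lra.
  have rc u v : u < c < v -> u < v -> (u < c) && (c < v) by [].
  have [|s1 [s2 [[s1P s1c] [s2P s2b]]]] :=
    chain_split (r := <%R) (phi := fun u v => - step_inf S h u v)
      (fun u v => id) rc (lexx 0) step _ sP sb.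
    by rewrite ac.
  have chainN x l : chain_sum (fun u v => - step_inf S h u v) x l
      = - chain_sum (step_inf S h) x l.
    by elim: l x => [|y l ih] x /=; rewrite ?oppr0// ih opprD.
  rewrite !chainN addr0 -opprD lerN2 => /le_trans; apply.
  by apply: lerD; apply: ub_le_sup => //; [exists s1|exists s2] => //;
    split => //; exact/eqP.
rewrite -lerBrDl; apply: ge_sup => // _ [s2 s2P <-].
rewrite lerBrDl -lerBrDr; apply: ge_sup => // _ [s1 s1P <-].
rewrite lerBrDr; apply: ub_le_sup => //; exists (s1 ++ s2).
  exact: itv_partition_cat s1P s2P.
by rewrite chain_sum_cat; have [_ /eqP ->] := s1P.
Qed.

Lemma darboux_stieltjes : stieltjes_integral S h lo hi (darboux S h).
Proof.
split=> [a c b loa|a b m M loa]; rewrite le_eqVlt => /predU1P[<-|].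
- by rewrite darboux_xx add0r.
- move=> ac; rewrite le_eqVlt => /predU1P[<-|cb bhi].
    by rewrite darboux_xx addr0.
  exact: darboux_catE.
- by rewrite darboux_xx subrr !mulr0 lexx.
- move=> ab bhi hb; have [ne ub] := has_sup_darboux loa ab bhi.
  apply/andP; split; last first.
    apply: ge_sup => // _ [s sP <-].
    by have /andP[] := chain_sum_step_inf_bounds loa bhi hb sP.
  case: (ne) => x [s sP sx].
  have /andP[mx _] := chain_sum_step_inf_bounds loa bhi hb sP.
  by apply: (le_trans mx); apply: ub_le_sup => //; exists s.
Qed.

End Fixed.
End Darboux.

(** * Differentiation with respect to an increasing function *)

Section StieltjesDerivative.
Context {R : realType}.
Implicit Types (a b c d e l t u v lo hi : R) (S h k : R -> R).
Implicit Types (L : R -> R -> R).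

Definition is_stieltjes_derivative S h t l : Prop :=
  (h x - h t) / (S x - S t) @[x --> t^'] --> l.

Lemma eq_cvg_to (f g : R -> R) (F : set_system R) l :
  f x @[x --> F] --> l -> f =1 g -> g x @[x --> F] --> l.
Proof. by move=> + /funext <-. Qed.

Lemma near_cvg_to (f g : R -> R) (F : set_system R) l : Filter F ->
  (\forall x \near F, f x = g x) ->
  f x @[x --> F] --> l -> g x @[x --> F] --> l.
Proof. by move=> FF fg; apply: cvg_trans; exact: near_eq_cvg. Qed.

Lemma dnbhs_segment lo hi t d : lo < t < hi -> 0 < d ->
  \forall x \near t^', [/\ lo < x < hi, `|x - t| < d & x != t].
Proof.
move=> /andP[lot thi] d0; apply/nbhs_ballP.
exists (Num.min d (Num.min (t - lo) (hi - t))) => /=.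
  by rewrite !lt_min d0 !subr_gt0 lot.
move=> x; rewrite /ball/= distrC !lt_min => /and3P[xd xlo xhi] xt; split=> //.
by move: xlo xhi; rewrite !ltr_norml; lra.
Qed.

Definition signed_integral L a t : R := if a <= t then L a t else - L t a.

Section Fixed.
Variables (S : R -> R) (lo hi : R).
Hypothesis S_incr : forall u v, lo < u -> u < v -> v < hi -> S u < S v.
Hypothesis S_cont : forall t, lo < t < hi -> {for t, continuous S}.

Let S_neq t x : lo < t < hi -> lo < x < hi -> x != t -> S x - S t != 0.
Proof.
move=> /andP[? ?] /andP[? ?]; rewrite neq_lt subr_eq0 => /orP[xt|tx].
  by rewrite lt_eqF// S_incr.
by rewrite gt_eqF// S_incr.
Qed.

Lemma is_stieltjes_derivative_cst c t : is_stieltjes_derivative S (cst c) t 0.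
Proof.
rewrite /is_stieltjes_derivative (_ : (fun _ => _) = cst 0).
  exact: cvg_cst.
by apply/funext => x /=; rewrite subrr mul0r.
Qed.

Lemma is_stieltjes_derivativeD h k t l l' :
  is_stieltjes_derivative S h t l -> is_stieltjes_derivative S k t l' ->
  is_stieltjes_derivative S (fun x => h x + k x) t (l + l').
Proof.
by move=> hl kl; apply: eq_cvg_to (cvgD hl kl) _ => x /=; ring.
Qed.

Lemma is_stieltjes_derivativeN h t l : is_stieltjes_derivative S h t l ->
  is_stieltjes_derivative S (fun x => - h x) t (- l).
Proof.
by move=> hl; apply: eq_cvg_to (cvgN hl) _ => x /=; ring.
Qed.

(** This is where the continuity of [S] is needed: at a jump of [S] a
    difference quotient may converge although [h] jumps. *)
Lemma stieltjes_derivative_continuous h t l : lo < t < hi ->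
  is_stieltjes_derivative S h t l -> {for t, continuous h}.
Proof.
move=> tin hl; apply/continuous_withinNx.
have Sx : S x - S t @[x --> t^'] --> 0.
  rewrite -(subrr (S t)); apply: cvgB; last exact: cvg_cst.
  exact/continuous_withinNx/S_cont.
have slope : (h x - h t) / (S x - S t) * (S x - S t) + h t @[x --> t^'] --> h t.
  rewrite -[X in _ --> X]add0r -(mulr0 l).
  by apply: cvgD; [exact: cvgM|exact: cvg_cst].
move: slope; apply: near_cvg_to.
near=> x; have [xin _ xt] : [/\ lo < x < hi, `|x - t| < 1 & x != t].
  by near: x; exact: dnbhs_segment.
by rewrite /= divfK ?subrK// S_neq.
Unshelve. all: by end_near. Qed.

Lemma is_stieltjes_derivativeM h k t l l' : lo < t < hi ->
  is_stieltjes_derivative S h t l -> is_stieltjes_derivative S k t l' ->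
  is_stieltjes_derivative S (fun x => h x * k x) t (l * k t + h t * l').
Proof.
move=> tin hl kl.
have kc := (continuous_withinNx _ _).1 (stieltjes_derivative_continuous tin kl).
apply: eq_cvg_to (cvgD (cvgM hl kc) (cvgM (cvg_cst (h t)) kl)) _ => x /=.
by ring.
Qed.

(** Caratheodory's slope function makes the chain rule insensitive to the
    points where [h x = h t]. *)
Lemma is_stieltjes_derivative_expR h t l : lo < t < hi ->
  is_stieltjes_derivative S h t l ->
  is_stieltjes_derivative S (fun x => expR (h x)) t (expR (h t) * l).
Proof.
move=> tin hl.
have hc := (continuous_withinNx _ _).1 (stieltjes_derivative_continuous tin hl).
have /is_derive1_caratheodory[q [qE qc qt]] := is_derive_expR (h t).
have qh : q (h x) @[x --> t^'] --> expR (h t).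
  by rewrite -qt; exact: cvg_comp hc qc.
by apply: eq_cvg_to (cvgM qh hl) _ => x /=; rewrite qE mulrA.
Qed.

Lemma stieltjes_derivative_eq0_cst h :
  (forall t, lo < t < hi -> is_stieltjes_derivative S h t 0) ->
  forall a b, lo < a < hi -> lo < b < hi -> h a = h b.
Proof.
move=> h0.
have main a b : lo < a -> a <= b -> b < hi -> h b - h a = 0.
  move=> loa ab bhi.
  apply: (@additive_locally_small_eq0 R S (fun u v => h v - h u)) => //.
    by move=> u c v _ _ _ _; ring.
  move=> e e0 t /andP[at_ tb].
  have tin : lo < t < hi by rewrite (lt_le_trans loa)// (le_lt_trans tb).
  have /cvgrPdist_le /(_ _ e0) /nbhs_ballP[d /= d0 hd] := h0 t tin.
  have hdx x : lo < x < hi -> `|x - t| < d -> `|h x - h t| <= e * `|S x - S t|.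
    have [->|xt] := eqVneq x t; first by rewrite !subrr !normr0 mulr0.
    move=> xin xd; have := hd x; rewrite /ball/= distrC => /(_ xd xt).
    rewrite sub0r normrN normrM normfV ler_pdivrMr ?normr_gt0//.
    exact: S_neq.
  exists d => // u v au ut tv vb uvd.
  have lou := lt_le_trans loa au; have vhi := le_lt_trans vb bhi.
  have uin : lo < u < hi by rewrite lou (le_lt_trans ut)// (le_lt_trans tv).
  have vin : lo < v < hi by rewrite vhi andbT (lt_le_trans lou)// (le_trans ut).
  have Sut : S u <= S t.
    move: ut; rewrite le_eqVlt => /predU1P[->//|ut].
    by rewrite ltW// S_incr// (le_lt_trans tv).
  have Stv : S t <= S v.
    move: tv; rewrite le_eqVlt => /predU1P[->//|tv].
    by rewrite ltW// S_incr// (lt_le_trans lou).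
  have hu : `|h u - h t| <= e * `|S u - S t|.
    by apply: hdx => //; rewrite ltr_norml; lra.
  have hv : `|h v - h t| <= e * `|S v - S t|.
    by apply: hdx => //; rewrite ltr_norml; lra.
  have Sv : `|S v - S t| = S v - S t by rewrite ger0_norm// subr_ge0.
  have Su : `|S u - S t| = S t - S u by rewrite distrC ger0_norm// subr_ge0.
  by move: hu hv; rewrite Su Sv !ler_norml; lra.
move=> a b /andP[loa ahi] /andP[lob bhi]; have [ab|/ltW ba] := leP a b.
  by apply/eqP; rewrite eq_sym -subr_eq0 main.
by apply/eqP; rewrite -subr_eq0 main.
Qed.

Lemma signed_integral_sub h L a u v : stieltjes_integral S h lo hi L ->
  lo < a < hi -> lo < u -> u <= v -> v < hi ->
  signed_integral L a v - signed_integral L a u = L u v.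
Proof.
move=> [add _] /andP[loa ahi] lou uv vhi; rewrite /signed_integral.
have [av|va] := leP a v; have [au|ua] := leP a u.
- by rewrite (add a u v)//; ring.
- by rewrite (add u a v)// ?ltW//; ring.
- by have := le_lt_trans (le_trans au uv) va; rewrite ltxx.
- by rewrite (add u v a)// ?ltW//; ring.
Qed.

(** Over a short segment the mean value bounds squeeze the difference quotient
    between the extreme values of [h] there. *)
Lemma signed_integral_primitive h L a t :
  (forall t, lo < t < hi -> {for t, continuous h}) ->
  stieltjes_integral S h lo hi L -> lo < a < hi -> lo < t < hi ->
  is_stieltjes_derivative S (signed_integral L a) t (h t).
Proof.
move=> hc hL ain tin; apply/cvgrPdist_le => e e0.
have [d d0 dh] := continuous_near (hc t tin) e0.
near=> x; have [xin xd xt] : [/\ lo < x < hi, `|x - t| < d & x != t].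
  by near: x; exact: dnbhs_segment.
have [/andP[lot thi] /andP[lox xhi]] := (tin, xin).
rewrite ler_norml; move: xt; rewrite neq_lt => /orP[xt|tx].
  have S0 : 0 < S t - S x by rewrite subr_gt0 S_incr.
  have -> : (signed_integral L a x - signed_integral L a t) / (S x - S t)
      = L x t / (S t - S x).
    rewrite -(signed_integral_sub hL ain lox (ltW xt) thi).
    by rewrite -(opprB (S t)) invrN mulrN -mulNr opprB.
  have hb y : x <= y <= t -> h t - e <= h y <= h t + e.
    by move=> xyt; apply: dh; move: xd; rewrite !ltr_norml; lra.
  have := hL.2 x t _ _ lox (ltW xt) thi hb.
  by rewrite -(ler_pdivlMr _ _ S0) -(ler_pdivrMr _ _ S0); lra.
have S0 : 0 < S x - S t by rewrite subr_gt0 S_incr.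
rewrite (signed_integral_sub hL ain lot (ltW tx) xhi).
have hb y : t <= y <= x -> h t - e <= h y <= h t + e.
  by move=> txy; apply: dh; move: xd; rewrite !ltr_norml; lra.
have := hL.2 t x _ _ lot (ltW tx) xhi hb.
by rewrite -(ler_pdivlMr _ _ S0) -(ler_pdivrMr _ _ S0); lra.
Unshelve. all: by end_near. Qed.

End Fixed.
End StieltjesDerivative.

(** * The linear equation in one real variable *)

Section LinearEquation.
Context {R : realType}.
Variables (S : R -> R) (lo hi : R).
Hypothesis S_incr : forall u v, lo < u -> u < v -> v < hi -> S u < S v.
Hypothesis S_cont : forall t, lo < t < hi -> {for t, continuous S}.
Implicit Types (t c : R) (p g y P I : R -> R).

Lemma is_stieltjes_derivative_near y z t l : lo < t < hi ->
  (forall x, lo < x < hi -> y x = z x) ->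
  is_stieltjes_derivative S y t l -> is_stieltjes_derivative S z t l.
Proof.
move=> tin yz; apply: near_cvg_to; near=> x.
have [xin _ _] : [/\ lo < x < hi, `|x - t| < 1 & x != t].
  by near: x; exact: dnbhs_segment.
by rewrite !yz.
Unshelve. all: by end_near. Qed.

(** If [P] is a primitive of [p], then [expR (P t)] turns the left-hand side of
    the equation into a derivative: [(expR P * y)' = expR P * (y' + p y)]. *)
Lemma linear_equation_solutions p g P I y :
  (forall t, lo < t < hi -> is_stieltjes_derivative S P t (p t)) ->
  (forall t, lo < t < hi ->
     is_stieltjes_derivative S I t (expR (P t) * g t)) ->
  (forall t, lo < t < hi -> exists2 dy, is_stieltjes_derivative S y t dy &
     dy + p t * y t = g t) <->
  exists c, forall t, lo < t < hi -> y t = (I t + c) / expR (P t).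
Proof.
move=> dP dI.
split=> [sol|[c yE] t tin].
- have d0 t : lo < t < hi ->
      is_stieltjes_derivative S (fun x => expR (P x) * y x + - I x) t 0.
    move=> tin; have [dy ydy eq_t] := sol t tin.
    have dmu := is_stieltjes_derivative_expR S_incr S_cont tin (dP t tin).
    have := is_stieltjes_derivativeD
      (is_stieltjes_derivativeM S_incr S_cont tin dmu ydy)
      (is_stieltjes_derivativeN (dI t tin)).
    by rewrite -eq_t; congr (is_stieltjes_derivative _ _ _ _); ring.
  have cst := stieltjes_derivative_eq0_cst S_incr d0.
  have [[t0 t0in]|none] := pselect (exists t, lo < t < hi); last first.
    by exists 0 => t tin; case: none; exists t.
  exists (expR (P t0) * y t0 - I t0) => t tin.
  have := cst t t0 tin t0in => /= <-.
  by field; rewrite gt_eqF// expR_gt0.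
- exists (g t - p t * y t); last by rewrite subrK.
  (* The product form of the solution avoids a quotient rule. *)
  pose z x := (I x + c) * expR (- P x).
  have zy x : lo < x < hi -> z x = y x by move=> xin; rewrite yE// /z expRN.
  apply: (is_stieltjes_derivative_near tin zy).
  have dE := is_stieltjes_derivative_expR S_incr S_cont tin
    (is_stieltjes_derivativeN (dP t tin)).
  have := is_stieltjes_derivativeM S_incr S_cont tin
    (is_stieltjes_derivativeD (dI t tin) (is_stieltjes_derivative_cst S c t))
    dE.
  rewrite -zy// /z /= addr0 expRN; congr (is_stieltjes_derivative _ _ _ _).
  by field; rewrite gt_eqF// expR_gt0.
Qed.

End LinearEquation.

(** * Continuity of the staircase function *)

Section Mass.
Context {R : realType} {n : nat}.
Implicit Types (w : R -> 'rV[R]_n) (x : 'rV[R]_n).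
Implicit Types (a b c d e u v delta alpha : R) (s : seq R).

Lemma enorm_ge0 x : 0 <= enorm x.
Proof. exact: sqrtr_ge0. Qed.

Lemma enorm0 : enorm (0 : 'rV[R]_n) = 0.
Proof.
by rewrite /enorm big1 ?sqrtr0// => i _; rewrite mxE expr0n.
Qed.

Lemma enormN x : enorm (- x) = enorm x.
Proof.
by rewrite /enorm; congr Num.sqrt; apply: eq_bigr => i _; rewrite mxE sqrrN.
Qed.

Lemma coord_le_enorm x i : `|x ord0 i| <= enorm x.
Proof.
rewrite -sqrtr_sqr ler_wsqrtr//.
by rewrite (bigD1 i)//= lerDl sumr_ge0// => j _; exact: sqr_ge0.
Qed.

Lemma enorm_lt x e : 0 < e -> (forall i, `|x ord0 i| < e / n.+1%:R) ->
  enorm x < e.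
Proof.
move=> e0 xe; rewrite -(ger0_norm (ltW e0)) -sqrtr_sqr ltr_sqrt ?exprn_gt0//.
pose k : R := n.+1%:R; have k0 : 0 < k by rewrite ltr0n.
apply: (@le_lt_trans _ _ (n%:R * (e / k) ^+ 2)).
  rewrite -[n in n%:R]card_ord mulr_natl -sumr_const; apply: ler_sum => i _.
  rewrite -real_normK ?num_real//; apply: lerXn2r; rewrite ?nnegrE//.
    by rewrite ltW// divr_gt0.
  by rewrite ltW// xe.
have -> : e ^+ 2 = k ^+ 2 * (e / k) ^+ 2 by field; rewrite gt_eqF.
have ek0 : 0 < (e / k) ^+ 2 by rewrite exprn_gt0 ?divr_gt0.
rewrite ltr_pM2r // (lt_le_trans (_ : n%:R < k)) ?ltr_nat//.
by rewrite expr2 ler_peMl ?ler1n// ltW.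
Qed.

Definition mass_step w alpha u v : R :=
  enorm (w v - w u) `^ alpha / Gamma (alpha + 1).

Lemma mass_sumE w alpha a b s :
  mass_sum w alpha a b s = chain_sum (mass_step w alpha) a s.
Proof. by rewrite -(chain_sumE _ a b). Qed.

(** With the mesh bound in the relation between consecutive points,
    [chain_split] applies to subdivisions of bounded mesh. *)
Definition fine_step delta : rel R := fun u v => (u < v) && (v - u <= delta).

Lemma fine_pathP delta a b s : 0 <= delta ->
  (itv_partition a b s /\ mesh a b s <= delta) <->
  (path (fine_step delta) a s /\ last a s = b).
Proof.
move=> d0; have mesh_path : path <%R a s -> 
    (mesh a b s <= delta) = path (fine_step delta) a s.
  elim: s a => [|x s ih] a; first by rewrite /mesh big_nil.
  move=> /= /andP[ax xs].
  by rewrite /mesh big_nat_recl//= ge_max {1}/fine_step ax/= -ih.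
split=> [[[sP /eqP sb] sm]|[sP sb]]; first by rewrite -mesh_path.
have lt_s : path <%R a s by apply: sub_path sP => u v /andP[].
by split; [split=> //; exact/eqP|rewrite mesh_path].
Qed.

Lemma Gamma_ge0 (r : R) : 0 <= Gamma r.
Proof.
by apply: Rintegral_ge0 => t _; rewrite mulr_ge0 ?powR_ge0 ?expR_ge0.
Qed.

(** As [1 <= alpha], the power is at most its base once the latter is below
    [1]. *)
Lemma scaled_powR_small alpha K e : 1 <= alpha -> 0 <= K -> 0 < e ->
  exists2 m, 0 < m & forall k, 0 <= k < m -> k `^ alpha * K < e.
Proof.
move=> alpha1 K0 e0; have K1 : 0 < K + 1 by rewrite ltr_wpDl.
exists (Num.min 1 (e / (K + 1))); first by rewrite lt_min ltr01 divr_gt0.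
move=> k; rewrite lt_min => /and3P[k0 k1 ke].
apply: (@le_lt_trans _ _ (k * K)).
  rewrite ler_wpM2r//; move: k0; rewrite le_eqVlt => /predU1P[<-|k0].
    by rewrite powR0// gt_eqF// (lt_le_trans ltr01).
  by rewrite ge1r_powR// k0 ltW.
apply: (@le_lt_trans _ _ (k * (K + 1))); first by rewrite ler_wpM2l// lerDl.
by rewrite -ltr_pdivlMr.
Qed.

Lemma mass_step_ge0 w alpha u v : 0 <= mass_step w alpha u v.
Proof. by apply: divr_ge0; [exact: powR_ge0|exact: Gamma_ge0]. Qed.

Lemma mass_step_small w alpha a0 b0 t e :
  (forall m, 0 < m -> exists2 d, 0 < d & forall u, a0 <= u <= b0 ->
     `|u - t| < d -> enorm (w u - w t) < m) ->
  1 <= alpha -> 0 < e -> exists2 d, 0 < d &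
    forall u, a0 <= u <= b0 -> `|u - t| < d ->
      mass_step w alpha u t < e /\ mass_step w alpha t u < e.
Proof.
move=> w_cont alpha1 e0.
have K0 : 0 <= (Gamma (alpha + 1))^-1 by rewrite invr_ge0; exact: Gamma_ge0.
have [m m0 small] := scaled_powR_small alpha1 K0 e0.
have [d d0 wd] := w_cont m m0.
exists d => [//|u uin ut]; have wut := wd u uin ut.
have N0 : 0 <= enorm (w u - w t) < m by rewrite enorm_ge0 wut.
split; last exact: small.
by rewrite /mass_step -[w t - w u]opprB enormN; exact: small.
Qed.

(** The estimates below only use that the cost [phi] of a step is nonnegative
    and vanishes with the length of the step. *)
Section Cost.
Variables (phi : R -> R -> R) (a0 b0 : R).
Hypothesis phi_ge0 : forall u v, 0 <= phi u v.
Hypothesis phi_small : forall t e, a0 <= t <= b0 -> 0 < e ->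
  exists2 d, 0 < d & forall u, a0 <= u <= b0 -> `|u - t| < d ->
    phi u t < e /\ phi t u < e.
Local Open Scope ereal_scope.

Definition coarse_cost a b delta : \bar R :=
  ereal_inf [set (chain_sum phi a s)%:E | s in
    [set s | path (fine_step delta) a s /\ last a s = b]].

(** The coarse costs increase as the mesh decreases, so their limit is a
    supremum. *)
Definition cost a b : \bar R :=
  ereal_sup [set coarse_cost a b d | d in `]0%R, +oo[].

Lemma coarse_cost_le a b d1 d2 : (d1 <= d2)%R ->
  coarse_cost a b d2 <= coarse_cost a b d1.
Proof.
move=> d12; apply: ereal_inf_le_tmp => _ [s [sP sb] <-].
exists s => //; split=> //; apply: sub_path sP => u v /andP[uv uvd].
by apply/andP; split=> //; exact: le_trans d12.
Qed.

Lemma coarse_cost_ge0 a b delta : 0 <= coarse_cost a b delta.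
Proof.
apply: le_ereal_inf_tmp => _ [s _ <-]; rewrite lee_fin.
by elim: s a => //= x s ih a; rewrite addr_ge0.
Qed.

Lemma coarse_le_cost a b delta : (0 < delta)%R ->
  coarse_cost a b delta <= cost a b.
Proof.
move=> d0; apply: ereal_sup_ubound; exists delta => //=.
by rewrite in_itv/= d0.
Qed.

Lemma cost_ge0 a b : 0 <= cost a b.
Proof. exact: le_trans (coarse_cost_ge0 a b 1) (coarse_le_cost a b ltr01). Qed.

Lemma coarse_cost_cat a c b delta :
  coarse_cost a b delta <= coarse_cost a c delta + coarse_cost c b delta.
Proof.
have [acfin|] := boolP (coarse_cost a c delta \is a fin_num); last first.
  have := coarse_cost_ge0 a c delta; have := coarse_cost_ge0 c b delta.
  case: (coarse_cost a c delta) => // cb0 _ _.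
  by rewrite addye ?leey// -ltNye (lt_le_trans _ cb0).
rewrite addeC -leeBlDr//; apply: le_ereal_inf_tmp => _ [s2 [s2P s2b] <-].
rewrite leeBlDr// addeC -leeBlDr//.
apply: le_ereal_inf_tmp => _ [s1 [s1P s1c] <-].
rewrite leeBlDr// -EFinD; apply: ereal_inf_lbound; exists (s1 ++ s2).
  by split; rewrite ?cat_path ?last_cat s1c// s1P.
by rewrite chain_sum_cat s1c.
Qed.

Lemma coarse_cost_step u v delta : (u < v)%R -> (v - u <= delta)%R ->
  coarse_cost u v delta <= (phi u v)%:E.
Proof.
move=> uv uvd; apply: ereal_inf_lbound; exists [:: v] => /=.
  by rewrite /fine_step uv uvd.
by rewrite addr0.
Qed.

(** Inserting [c] into a subdivision creates two steps next to [c], which are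
    cheap when the mesh is small. *)
Lemma coarse_cost_split a c b delta e : (a0 <= a)%R -> (a < c)%R ->
  (c < b)%R -> (b <= b0)%R -> (0 < delta)%R -> (0 < e)%R ->
  coarse_cost a c delta + coarse_cost c b delta <= cost a b + e%:E.
Proof.
move=> a0a ac cb bb0 d0 e0.
have cin : (a0 <= c <= b0)%R.
  by rewrite (le_trans a0a (ltW ac)) (le_trans (ltW cb) bb0).
have e2 : (0 < e / 2)%R by rewrite divr_gt0.
have [d dgt0 phid] := phi_small cin e2.
pose d' := Num.min delta (d / 2)%R.
have d'0 : (0 < d')%R by rewrite lt_min d0 divr_gt0.
have d'delta : (d' <= delta)%R by rewrite ge_min lexx.
have d'd : (d' < d)%R.
  have d2 : (d / 2 < d)%R by lra.
  by rewrite gt_min d2 orbT.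
apply: (@le_trans _ _ (coarse_cost a b d' + e%:E)); last first.
  by rewrite leeD2r// coarse_le_cost.
rewrite -leeBlDr//; apply: le_ereal_inf_tmp => _ [s [sP sb] <-].
rewrite leeBlDr// -EFinD.
have step u v : (a <= u)%R -> (v <= b)%R -> (u < c < v)%R -> fine_step d' u v ->
    (phi u c + phi c v <= phi u v + e)%R.
  move=> au vb /andP[uc cv] /andP[_ uvd].
  have [||phiuc _] := phid u.
  - by rewrite (le_trans a0a au) (le_trans (ltW uc)) ?(andP cin).2.
  - by rewrite ltr_norml; lra.
  have [||_ phicv] := phid v.
  - by rewrite (le_trans vb bb0) (le_trans _ (ltW cv)) ?(andP cin).1.
  - by rewrite ltr_norml; lra.
  by have := phi_ge0 u v; lra.
have rc u v : (u < c < v)%R -> fine_step d' u v ->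
    fine_step d' u c && fine_step d' c v.
  rewrite /fine_step => /andP[uc cv] /andP[_ uvd]; rewrite uc cv /=.
  by apply/andP; split; lra.
have [||s1 [s2 [[s1P s1c] [s2P s2b]] chainle]] :=
  chain_split _ rc (ltW e0) step _ sP sb.
- by move=> u v /andP[].
- by rewrite ac.
apply: (@le_trans _ _ (chain_sum phi a s1 + chain_sum phi c s2)%:E).
  rewrite EFinD; apply: leeD.
    apply: le_trans (coarse_cost_le a c d'delta) _.
    by apply: ereal_inf_lbound; exists s1.
  apply: le_trans (coarse_cost_le c b d'delta) _.
  by apply: ereal_inf_lbound; exists s2.
by rewrite lee_fin.
Qed.

Lemma cost_xx a : cost a a = 0.
Proof.
apply/eqP; rewrite eq_le cost_ge0 andbT.
apply: ge_ereal_sup => _ [d _ <-].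
by apply: ereal_inf_lbound; exists [::].
Qed.

Lemma cost_superadditive a c b : (a0 <= a)%R -> (a <= c)%R -> (c <= b)%R ->
  (b <= b0)%R -> cost a c + cost c b <= cost a b.
Proof.
move=> a0a; rewrite le_eqVlt => /predU1P[<- _ _|ac].
  by rewrite cost_xx add0e.
rewrite le_eqVlt => /predU1P[<- _|cb bb0].
  by rewrite cost_xx adde0.
have sum_le d1 d2 : (0 < d1)%R -> (0 < d2)%R ->
    coarse_cost a c d1 + coarse_cost c b d2 <= cost a b.
  move=> d1_0 d2_0; pose d := Num.min d1 d2.
  apply: (@le_trans _ _ (coarse_cost a c d + coarse_cost c b d)).
    by apply: leeD; apply: coarse_cost_le; rewrite ge_min lexx ?orbT.
  apply/lee_addgt0Pr => e e0; apply: coarse_cost_split => //.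
  by rewrite lt_min d1_0.
have [abfin|] := boolP (cost a b \is a fin_num); last first.
  by case: (cost a b) (cost_ge0 a b) => // _ _; rewrite leey.
have fin_le (x : \bar R) : 0 <= x -> x <= cost a b -> x \is a fin_num.
  move=> x0 xab; rewrite ge0_fin_numE//; apply: le_lt_trans xab _.
  by rewrite ltey_eq abfin.
have coarse_fin d : (0 < d)%R -> coarse_cost c b d \is a fin_num.
  move=> d0; apply: fin_le; first exact: coarse_cost_ge0.
  apply: le_trans (sum_le 1%R d ltr01 d0).
  by rewrite leeDr// coarse_cost_ge0.
have le1 d : (0 < d)%R -> cost a c + coarse_cost c b d <= cost a b.
  move=> d0; rewrite -leeBrDr ?coarse_fin//.
  apply: ge_ereal_sup => _ [d1 /= + <-]; rewrite in_itv/= andbT => d1_0.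
  by rewrite leeBrDr ?coarse_fin// sum_le.
have acfin : cost a c \is a fin_num.
  apply: fin_le; first exact: cost_ge0.
  by apply: le_trans (le1 1%R ltr01); rewrite leeDl// coarse_cost_ge0.
rewrite -leeBrDl//; apply: ge_ereal_sup => _ [d /= + <-].
by rewrite in_itv/= andbT => d0; rewrite leeBrDl// le1.
Qed.

(** A subdivision that is nearly optimal for its mesh may be compared with one
    that contains the single step from [u] to [v]: its cost is about
    [cost a b], which is at least [cost a v + cost v b]. *)
Lemma cost_continuity a b e : (a0 <= a)%R -> (a <= b)%R -> (b <= b0)%R ->
  cost a b \is a fin_num -> (0 < e)%R -> exists2 d, (0 < d)%R &
  forall u v, (a <= u)%R -> (u < v)%R -> (v <= b)%R -> (v - u <= d)%R ->
    (fine (cost a v) - fine (cost a u) <= phi u v + e)%R /\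
    (fine (cost u b) - fine (cost v b) <= phi u v + e)%R.
Proof.
move=> a0a ab bb0 abfin e0.
have [_ [d /= + <-] near_ab] := ub_ereal_sup_adherent e0 abfin.
rewrite in_itv/= andbT => d0; exists d => // u v au uv vb uvd.
have av := le_trans au (ltW uv); have ub := le_trans (ltW uv) vb.
have sub (x : R) : (a <= x)%R -> (x <= b)%R -> cost a x + cost x b <= cost a b.
  by move=> ax xb; exact: cost_superadditive.
have fin (x : R) : (a <= x)%R -> (x <= b)%R ->
    cost a x \is a fin_num /\ cost x b \is a fin_num.
  move=> ax xb; have := sub x ax xb; have := cost_ge0 a x; have := cost_ge0 x b.
  case: (cost a b) abfin => // r _.
  by case: (cost a x); case: (cost x b).
have : cost a b <= cost a u + ((phi u v)%:E + cost v b) + e%:E.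
  rewrite -leeBlDr//; apply: le_trans (ltW near_ab) _.
  apply: le_trans (coarse_cost_cat a u b d) _.
  apply: leeD; first exact: coarse_le_cost.
  apply: le_trans (coarse_cost_cat u v b d) _.
  by apply: leeD; [exact: coarse_cost_step|exact: coarse_le_cost].
have [auf ubf] := fin u au ub; have [avf vbf] := fin v av vb.
have := sub u au ub; have := sub v av vb.
rewrite -(fineK auf) -(fineK ubf) -(fineK avf) -(fineK vbf) -(fineK abfin).
rewrite -!EFinD !lee_fin => /= h1 h2 h3; split; lra.
Qed.

End Cost.

End Mass.

(** The increments are only controlled between points on the same side of
    [p0]; this suffices, because a neighbour of [t] lies on the side of [t],
    and [p0] itself lies on both sides. *)
Lemma continuous_from_increments {R : realType} (phi : R -> R -> R)
    (S : R -> R) (a0 b0 p0 t : R) :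
  (forall t e, a0 <= t <= b0 -> 0 < e -> exists2 d, 0 < d &
    forall u, a0 <= u <= b0 -> `|u - t| < d -> phi u t < e /\ phi t u < e) ->
  (forall u v, a0 <= u -> u < v -> v <= b0 -> S u < S v) ->
  (forall e, 0 < e -> exists2 d, 0 < d &
    forall u v, a0 <= u -> u < v -> v <= b0 -> v - u <= d ->
      (p0 <= u \/ v <= p0) -> S v - S u <= phi u v + e) ->
  a0 < t < b0 -> {for t, continuous S}.
Proof.
move=> phi_small S_lt S_incr.
move=> /andP[at_ tb]; apply/cvgrPdist_lt => e e0.
have e2 : 0 < e / 2 by rewrite divr_gt0.
have tin : a0 <= t <= b0 by rewrite !ltW.
have [d1 d1_0 incr] := S_incr _ e2.
have [d2 d2_0 phid] := phi_small _ _ tin e2.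
pose d3 := if t == p0 then 1 else `|t - p0|.
have d3_0 : 0 < d3.
  by rewrite /d3; case: eqVneq => // tp; rewrite normr_gt0 subr_eq0.
apply/nbhs_ballP.
exists (Num.min (Num.min d1 d2) (Num.min d3 (Num.min (t - a0) (b0 - t)))) => /=.
  by rewrite !lt_min d1_0 d2_0 d3_0 !subr_gt0 at_.
move=> x; rewrite /ball/= distrC !lt_min.
move=> /andP[/andP[xd1 xd2] /and3P[xd3 xa xb]].
have xin : a0 <= x <= b0 by move: xa xb; rewrite !ltr_norml; lra.
have [phixt phitx] := phid x xin xd2.
have [/andP[ax xb0] /andP[at0 tb0]] := (xin, tin).
have side : (p0 <= x /\ p0 <= t) \/ (x <= p0 /\ t <= p0).
  move: xd3; rewrite /d3; case: (ltgtP t p0) => [tp|pt|-> _].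
  - rewrite (ltr0_norm (_ : t - p0 < 0)) ?subr_lt0// ltr_norml => xd3.
    by right; split; lra.
  - rewrite (gtr0_norm (_ : 0 < t - p0)) ?subr_gt0// ltr_norml => xd3.
    by left; split; lra.
  - by have [px|/ltW xp] := leP p0 x; [left|right].
move: xd1; rewrite ltr_norml => /andP[xd1 xd1'].
have [xt|tx|->] := ltgtP x t; last by rewrite subrr normr0.
- have Sxt := S_lt _ _ ax xt tb0.
  have len : t - x <= d1 by lra.
  have := incr x t ax xt tb0 len; rewrite ltr_norml => /(_ _) incr_xt.
  have {}incr_xt : S t - S x <= phi x t + e / 2 by apply: incr_xt; tauto.
  by apply/andP; split; lra.
- have Stx := S_lt _ _ at0 tx xb0.
  have len : x - t <= d1 by lra.
  have := incr t x at0 tx xb0 len; rewrite ltr_norml => /(_ _) incr_tx.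
  have {}incr_tx : S x - S t <= phi t x + e / 2 by apply: incr_tx; tauto.
  by apply/andP; split; lra.
Qed.


Section Staircase.
Context {R : realType} {n : nat}.
Variables (w : R -> 'rV[R]_n) (a0 b0 alpha p0 : R).
Hypothesis w_cont : forall t m, a0 <= t <= b0 -> 0 < m ->
  exists2 d, 0 < d & forall u, a0 <= u <= b0 -> `|u - t| < d ->
    enorm (w u - w t) < m.
Hypothesis alpha1 : 1 <= alpha.
Implicit Types (a b d e t u v : R).

Let phi := mass_step w alpha.

Lemma mass_cost a b : mass w alpha a b = cost phi a b.
Proof.
have coarseE d : 0 <= d -> coarse_mass w alpha a b d = coarse_cost phi a b d.
  move=> d0; rewrite /coarse_mass /coarse_cost; congr ereal_inf.
  apply/seteqP; split=> _ [s /= sP <-]; exists s; rewrite ?mass_sumE//.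
    exact/(fine_pathP a b s d0).
  exact/(fine_pathP a b s d0).
apply: cvg_lim => //.
have cvg_cost : coarse_cost phi a b d @[d --> 0^'+] --> cost phi a b.
  apply: (nonincreasing_at_right_cvge +oo%O) => //.
  by move=> d1 d2 _ _; exact: coarse_cost_le.
apply: cvg_trans cvg_cost; apply: near_eq_cvg; near=> d.
by apply/esym/coarseE; near: d; exact: nbhs_right_ge.
Unshelve. all: by end_near. Qed.

Hypothesis p0_in : a0 <= p0 <= b0.
Hypothesis reg : regular_staircase w a0 b0 alpha p0.

Let S t := fine (staircase w alpha p0 t).

Lemma fine_staircase_lt u v : a0 <= u -> u < v -> v <= b0 -> S u < S v.
Proof.
move=> au uv vb; have [fin lt] := reg.
have uin : u \in `[a0, b0] by rewrite in_itv/= au (le_trans (ltW uv)).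
have vin : v \in `[a0, b0] by rewrite in_itv/= vb (le_trans au (ltW uv)).
by apply: fine_lt; [exact: fin|exact: fin|exact: lt].
Qed.

Let phi_ge0 u v : 0 <= phi u v.
Proof. exact: mass_step_ge0. Qed.

Let phi_small t e : a0 <= t <= b0 -> 0 < e -> exists2 d, 0 < d &
  forall u, a0 <= u <= b0 -> `|u - t| < d -> phi u t < e /\ phi t u < e.
Proof.
by move=> tin e0; apply: mass_step_small => // m; exact: w_cont.
Qed.

Let S_ge u : p0 <= u -> S u = fine (cost phi p0 u).
Proof. by move=> pu; rewrite /S /staircase pu mass_cost. Qed.

Let S_le u : u <= p0 -> S u = - fine (cost phi u p0).
Proof.
rewrite le_eqVlt => /predU1P[->|up]; first by rewrite S_ge// cost_xx// oppr0.
by rewrite /S /staircase leNgt up/= fineN mass_cost.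
Qed.

(** The staircase is given by two formulas, so points on the same side of
    [p0] are compared. *)
Lemma fine_staircase_increment e : 0 < e -> exists2 d, 0 < d &
  forall u v, a0 <= u -> u < v -> v <= b0 -> v - u <= d ->
    (p0 <= u \/ v <= p0) -> S v - S u <= phi u v + e.
Proof.
move=> e0; have [ap pb] := andP p0_in; have [fin _] := reg.
have fin_pb : cost phi p0 b0 \is a fin_num.
  have := fin b0; rewrite /staircase pb mass_cost; apply.
  by rewrite in_itv/= lexx (le_trans ap).
have fin_ap : cost phi a0 p0 \is a fin_num.
  move: ap; rewrite le_eqVlt => /predU1P[->|ap]; first by rewrite cost_xx.
  have := fin a0; rewrite /staircase leNgt ap/= mass_cost fin_numN; apply.
  by rewrite in_itv/= lexx (le_trans (ltW ap)).
have [d1 d1_0 right] :=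
  cost_continuity phi_ge0 phi_small ap pb (lexx _) fin_pb e0.
have [d2 d2_0 left] :=
  cost_continuity phi_ge0 phi_small (lexx _) ap pb fin_ap e0.
exists (Num.min d1 d2); first by rewrite lt_min d1_0.
move=> u v au uv vb; rewrite le_min => /andP[uv1 uv2] [pu|vp].
  rewrite !S_ge ?(le_trans pu (ltW uv))//.
  by have [] := right u v pu uv vb uv1.
rewrite !S_le ?(le_trans (ltW uv) vp)// opprK addrC.
by have [] := left u v au uv vp uv2.
Qed.

Lemma fine_staircase_continuous t : a0 < t < b0 -> {for t, continuous S}.
Proof.
apply: (continuous_from_increments phi_small fine_staircase_lt).
exact: fine_staircase_increment.
Qed.

End Staircase.

(** * From the curve to the parameter interval *)

Section Curve.
Context {R : realType} {n : nat}.
Variables (F : set 'rV[R]_n) (w : R -> 'rV[R]_n) (a0 b0 : R).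
Hypothesis curve : is_fractal_curve F w a0 b0.
Implicit Types (d e l m t u v : R) (f : 'rV[R]_n -> R).

Lemma curve_continuous t m : a0 <= t <= b0 -> 0 < m ->
  exists2 d, 0 < d & forall u, a0 <= u <= b0 -> `|u - t| < d ->
    enorm (w u - w t) < m.
Proof.
move=> tin m0; have tin' : `[a0, b0]%classic t by rewrite /= in_itv/= tin.
have mn0 : 0 < m / n.+1%:R by rewrite divr_gt0.
have /subspace_continuousP /(_ _ tin') /cvg_ballP /(_ _ mn0) := curve.1.
move=> /nbhs_ballP [d /= d0 wd]; exists d => // u uin ut.
have tu : ball t d u by rewrite /ball/= distrC.
have uin' : `[a0, b0]%classic u by rewrite /= in_itv/= uin.
have [_ wu] := wd u tu uin'.
apply: enorm_lt => // i.
by have := wu ord0 i; rewrite /ball/= !mxE distrC.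
Qed.

Lemma paramK t : a0 <= t <= b0 -> param w a0 b0 (w t) = t.
Proof.
move=> tin; apply: pinvKV; last by rewrite inE/= in_itv/= tin.
by have [_ /set_bij_inj] := curve.
Qed.

Lemma param_in theta : F theta ->
  a0 <= param w a0 b0 theta <= b0 /\ w (param w a0 b0 theta) = theta.
Proof.
have [_ /set_bij_surj Fsurj] := curve.
move=> /Fsurj [t /= + <-]; rewrite in_itv/= => tin.
by rewrite paramK.
Qed.

(** A continuous bijection from a compact segment is a homeomorphism: away from
    [t] the distance to [w t] is locally, hence globally, bounded below. *)
Lemma curve_inverse_continuous t e : a0 <= t <= b0 -> 0 < e ->
  exists2 d, 0 < d & forall u, a0 <= u <= b0 -> enorm (w u - w t) < d ->
    `|u - t| < e.
Proof.
move=> tin e0.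
pose G u v := exists2 d, 0 < d &
  forall x, u <= x <= v -> e <= `|x - t| -> d <= enorm (w x - w t).
suff [d d0 dG] : G a0 b0.
  exists d => // u uin wd; rewrite ltNge; apply/negP => eu.
  by have := dG u uin eu; rewrite leNgt wd.
apply: segment_local_global => [u c v _ _ _ _ [d1 d1_0 G1] [d2 d2_0 G2]|s sin|].
- exists (Num.min d1 d2); first by rewrite lt_min d1_0.
  move=> x /andP[ux xv] ex; rewrite ge_min.
  have [xc|cx] := leP x c; first by rewrite G1// ux.
  by rewrite G2 ?orbT// (ltW cx).
- have [st|st] := ltP `|s - t| e.
    exists (e - `|s - t|); first by rewrite subr_gt0.
    move=> u v au us sv vb uv; exists 1 => // x /andP[ux xv].
    rewrite leNgt => /negP[]; rewrite -(subrK s x) -addrA.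
    apply: le_lt_trans (ler_normD _ _) _; rewrite -ltrBrDr.
    by apply: le_lt_trans uv; rewrite ler_norml; lra.
  have [i wi] : exists i, w s ord0 i != w t ord0 i.
    apply/existsP; apply: contraTT st; rewrite negb_exists => /forallP ww.
    have wst : w s = w t.
      by apply/rowP => i; have := ww i; rewrite negbK => /eqP.
    rewrite -(paramK sin) -(paramK tin) wst subrr normr0 -ltNge//.
  pose h := `|w s ord0 i - w t ord0 i|.
  have h0 : 0 < h by rewrite normr_gt0 subr_eq0.
  have [d d0 wd] := curve_continuous sin (divr_gt0 h0 (ltr0n _ 2)).
  exists d => // u v au us sv vb uv; exists (h / 2); first by rewrite divr_gt0.
  move=> x /andP[ux xv] _.
  have xin : a0 <= x <= b0 by rewrite (le_trans au)// (le_trans xv).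
  have /(le_lt_trans (coord_le_enorm _ i)) : enorm (w x - w s) < h / 2.
    by apply: wd => //; rewrite ltr_norml; lra.
  rewrite !mxE => xs; apply: le_trans (coord_le_enorm _ i); rewrite !mxE.
  have : h <= `|w x ord0 i - w s ord0 i| + `|w x ord0 i - w t ord0 i|.
    rewrite [X in X + _]distrC; apply: le_trans (ler_normD _ _).
    by rewrite addrA subrK.
  by lra.
- by have /andP[/le_trans] := tin; exact.
Qed.

Variables (lo hi : R) (A : set 'rV[R]_n).
Hypothesis lo_ge : a0 <= lo.
Hypothesis hi_le : hi <= b0.
Hypothesis AE : forall theta, A theta <-> exists2 t, lo < t < hi & w t = theta.

Let in_curve t : lo < t < hi -> a0 <= t <= b0.
Proof.
move=> /andP[lot thi].
by rewrite (le_trans lo_ge (ltW lot)) (le_trans (ltW thi)).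
Qed.

Lemma F_limit_param f t l : lo < t < hi ->
  F_limit A f (w t) l <-> f (w x) @[x --> t^'] --> l.
Proof.
move=> tin; have tab := in_curve tin; split=> [fl|fl e e0].
  apply/cvgrPdist_lt => e e0; have [m m0 fm] := fl e e0.
  have [d d0 wd] := curve_continuous tab m0.
  near=> x; have [xin xd xt] : [/\ lo < x < hi, `|x - t| < d & x != t].
    by near: x; exact: dnbhs_segment.
  rewrite distrC; apply: fm; first by apply/AE; exists x.
  rewrite wd ?in_curve// andbT lt_neqAle enorm_ge0 andbT eq_sym.
  have xt0 : 0 < `|x - t| by rewrite normr_gt0 subr_eq0.
  have [d' d'0 wd'] := curve_inverse_continuous tab xt0.
  apply/negP => /eqP w0; have := wd' x (in_curve xin).
  by rewrite w0 ltxx => /(_ d'0).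
have /cvgrPdist_lt /(_ _ e0) /nbhs_ballP [d /= d0 fd] := fl.
have [m m0 wm] := curve_inverse_continuous tab d0.
exists m => // _ /AE [x xin <-] /andP[wx0 wxm].
rewrite distrC; apply: fd.
  by rewrite /ball/= distrC; apply: wm => //; exact: in_curve.
by apply: contraTneq wx0 => /= ->; rewrite subrr enorm0 ltxx.
Unshelve. all: by end_near. Qed.

Lemma F_continuous_param f :
  F_continuous A f <-> forall t, lo < t < hi -> {for t, continuous (f \o w)}.
Proof.
split=> [fc t tin|fc _ /AE [t tin <-]].
  apply/continuous_withinNx/F_limit_param => //.
  by apply: fc; apply/AE; exists t.
by apply/F_limit_param => //; exact/continuous_withinNx/fc.
Qed.

Lemma is_F_derivative_param J f t l : lo < t < hi ->
  is_F_derivative J A f (w t) l <->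
  is_stieltjes_derivative (J \o w) (f \o w) t l.
Proof. exact: F_limit_param. Qed.

Lemma F_primitive_param J h f : F_primitive J A h f <->
  forall t, lo < t < hi ->
    is_stieltjes_derivative (J \o w) (f \o w) t (h (w t)).
Proof.
split=> [fh t tin|fh _ /AE [t tin <-]].
  by apply/is_F_derivative_param => //; apply: fh; apply/AE; exists t.
by apply/is_F_derivative_param => //; exact: fh.
Qed.

Lemma is_solution_param J p g y : is_solution J A p g y <->
  forall t, lo < t < hi ->
    exists2 dy, is_stieltjes_derivative (J \o w) (y \o w) t dy &
      dy + (p \o w) t * (y \o w) t = (g \o w) t.
Proof.
split=> [sol t tin|sol _ /AE [t tin <-]].
  have [|dy ydy dyE] := sol (w t); first by apply/AE; exists t.
  by exists dy => //; exact/is_F_derivative_param.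
have [dy ydy dyE] := sol t tin.
by exists dy => //; exact/is_F_derivative_param.
Qed.

Lemma lower_integral_darboux J f a b :
  lower_integral J w f a b = darboux (J \o w) (f \o w) a b.
Proof.
rewrite /lower_integral /darboux; congr sup.
apply: eq_imagel => s _; rewrite /lower_sum /segment.
under eq_bigr do rewrite image_comp.
by rewrite (chain_sumE (step_inf (J \o w) (f \o w))).
Qed.

Lemma upper_integral_darboux J f a b :
  upper_integral J w f a b = - darboux (J \o w) (\- (f \o w)) a b.
Proof.
rewrite /upper_integral /darboux /inf; congr (- sup _).
rewrite image_comp; apply: eq_imagel => s _ /=.
rewrite /upper_sum /segment.
under eq_bigr do rewrite image_comp.
rewrite (chain_sumE (fun u v =>
  sup ((f \o w) @` `[u, v]) * ((J \o w) v - (J \o w) u))).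
elim: s a => [|x s ih] a /=; first by rewrite oppr0.
rewrite opprD ih -mulNr; congr (_ * _ + _).
rewrite /inf image_comp; congr (- sup _); apply: eq_imagel => z _ /=.
by rewrite opprK.
Qed.

Lemma stieltjes_integralN (S h : R -> R) L :
  stieltjes_integral S (\- h) lo hi L ->
  stieltjes_integral S h lo hi (fun a b => - L a b).
Proof.
move=> [add bd]; split=> [a c b loa ac cb bhi|a b m M loa ab bhi hb].
  by rewrite (add a c b)// opprD.
have hb' t : a <= t <= b -> - M <= - h t <= - m.
  by move=> /hb; rewrite !lerN2 andbC.
by have := bd a b _ _ loa ab bhi hb'; rewrite !mulNr; lra.
Qed.

Section Integral.
Variable J : 'rV[R]_n -> R.
Hypothesis J_incr : forall u v, lo < u -> u < v -> v < hi -> J (w u) < J (w v).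

Let J_mono u v : lo < u -> u <= v -> v < hi -> (J \o w) u <= (J \o w) v.
Proof.
by move=> lou; rewrite le_eqVlt => /predU1P[->//|uv vhi]; rewrite ltW// J_incr.
Qed.

(** The lower and the upper integral are both additive and both satisfy the
    mean value bounds, so they agree and are primitives. *)
Lemma F_integral_primitive f theta0 : F_continuous A f -> A theta0 ->
  (forall theta, A theta -> oriented_integrable J w a0 b0 f theta0 theta) /\
  F_primitive J A f (oriented_integral J w a0 b0 f theta0).
Proof.
move=> /F_continuous_param fc /AE [t0 t0in <-].
have fNc t : lo < t < hi -> {for t, continuous (\- (f \o w))}.
  by move=> tin; exact/continuousN/fc.
have lower := darboux_stieltjes J_mono fc.
have upper := stieltjes_integralN (darboux_stieltjes J_mono fNc).
split=> [_ /AE [t tin <-]|].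
  rewrite /oriented_integrable !paramK ?in_curve//.
  set a := Num.min _ _; set b := Num.max _ _.
  have loa : lo < a by rewrite lt_min (andP t0in).1 (andP tin).1.
  have bhi : b < hi by rewrite gt_max (andP t0in).2 (andP tin).2.
  have ab : a <= b by rewrite ge_min le_max lexx.
  split; last first.
    rewrite lower_integral_darboux upper_integral_darboux.
    exact: stieltjes_integral_unique fc lower upper loa ab bhi.
  have [|M Mf] := @continuous_segment_bounded R (f \o w) a b _ ab.
    move=> s /andP[as_ sb]; apply: fc.
    by rewrite (lt_le_trans loa)// (le_lt_trans sb).
  exists M; split; first exact: num_real.
  move=> N MN _ [s /= + <-]; rewrite in_itv/= => sab.
  exact: le_trans (Mf s sab) (ltW MN).
apply/F_primitive_param => t tin.
pose I := signed_integral (darboux (J \o w) (f \o w)) t0.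
apply: (@is_stieltjes_derivative_near _ _ lo hi I) => // [x xin|].
  rewrite /I /oriented_integral /signed_integral /= !paramK ?in_curve//.
  by rewrite !lower_integral_darboux.
exact: (signed_integral_primitive J_incr fc lower).
Qed.

End Integral.
End Curve.

(** * The integration factor *)

Theorem theorem1 (R : realType) (n : nat) (F : set 'rV[R]_n)
    (w : R -> 'rV[R]_n) (a0 b0 alpha p0 : R) (phi1 phi2 : 'rV[R]_n)
    (p g : 'rV[R]_n -> R) :
  let J := curve_staircase w a0 b0 alpha p0 in
  let A := [set theta | F theta /\ curve_lt w a0 b0 phi1 theta
                        /\ curve_lt w a0 b0 theta phi2] in
  is_fractal_curve F w a0 b0 ->
  1 <= alpha <= n%:R ->
  p0 \in `[a0, b0] ->
  regular_staircase w a0 b0 alpha p0 ->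
  F phi1 -> F phi2 -> curve_lt w a0 b0 phi1 phi2 ->
  F_continuous A p -> F_continuous A g ->
  exists mu : 'rV[R]_n -> R,
    [/\ F_differentiable J A mu,
        forall theta, A theta -> mu theta != 0,
        (* the integrand is F-continuous, and its integrals from a base point
           of A exist and are primitives of it *)
        F_continuous A (fun theta => mu theta * g theta)
        /\ (forall theta0, A theta0 ->
              (forall theta, A theta ->
                 oriented_integrable J w a0 b0
                   (fun tau => mu tau * g tau) theta0 theta)
              /\ F_primitive J A (fun theta => mu theta * g theta)
                   (oriented_integral J w a0 b0
                      (fun tau => mu tau * g tau) theta0))
      & (* whichever primitive the indefinite integral denotes *)
        forall I : 'rV[R]_n -> R,
          F_primitive J A (fun theta => mu theta * g theta) I ->
          forall y : 'rV[R]_n -> R,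
            is_solution J A p g y <->
            exists c : R, forall theta, A theta ->
              y theta = (I theta + c) / mu theta].

Proof.
move=> J A curve /andP[alpha1 _] p0in reg Fphi1 Fphi2 phi12 pc gc.
pose lo := param w a0 b0 phi1; pose hi := param w a0 b0 phi2.
have [/andP[lo_ge _] _] := param_in curve Fphi1.
have [/andP[_ hi_le] _] := param_in curve Fphi2.
have AE theta : A theta <-> exists2 t, lo < t < hi & w t = theta.
  split=> [[Ftheta [lot thi]]|[t /andP[lot thi] <-]].
    have [_ wK] := param_in curve Ftheta.
    by exists (param w a0 b0 theta) => //; apply/andP.
  have tin : a0 <= t <= b0.
    by rewrite (le_trans lo_ge (ltW lot)) (le_trans (ltW thi)).
  split; last by rewrite /curve_lt (paramK curve tin).
  by have [_ [wF _ _]] := curve; apply: wF; rewrite /= in_itv/=.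
have p0in' : a0 <= p0 <= b0 by move: p0in; rewrite in_itv.
have w_cont := curve_continuous curve.
have JE t : a0 <= t <= b0 -> J (w t) = fine (staircase w alpha p0 t).
  by move=> tin; rewrite /J /curve_staircase (paramK curve tin).
have J_incr u v : lo < u -> u < v -> v < hi -> J (w u) < J (w v).
  move=> lou uv vhi.
  have au := le_trans lo_ge (ltW lou); have vb := le_trans (ltW vhi) hi_le.
  rewrite !JE ?au ?vb ?(le_trans au (ltW uv)) ?(le_trans (ltW uv) vb)//.
  exact: (fine_staircase_lt reg).
have J_cont t : lo < t < hi -> {for t, continuous (J \o w)}.
  move=> tin; have [lot thi] := andP tin.
  have tab : a0 < t < b0 by rewrite (le_lt_trans lo_ge lot) (lt_le_trans thi).
  have St := fine_staircase_continuous w_cont alpha1 p0in' reg tab.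
  apply/continuous_withinNx; rewrite /= JE; last first.
    by rewrite (le_trans lo_ge (ltW lot)) (le_trans (ltW thi)).
  have /continuous_withinNx := St; apply: near_cvg_to; near=> x.
  have [/andP[lox xhi] _ _] : [/\ lo < x < hi, `|x - t| < 1 & x != t].
    by near: x; exact: dnbhs_segment.
  by rewrite JE// (le_trans lo_ge (ltW lox)) (le_trans (ltW xhi)).
have [t0 t0in] : exists t0, lo < t0 < hi.
  by exists ((lo + hi) / 2); move: phi12; rewrite /curve_lt -/lo -/hi => ?; lra.
have Aw t : lo < t < hi -> A (w t) by move=> tin; apply/AE; exists t.
have integral f theta0 := F_integral_primitive curve lo_ge hi_le AE J_incr
  (f := f) (theta0 := theta0).
have [_ /(F_primitive_param curve lo_ge hi_le AE) P_prim] :=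
  integral p (w t0) pc (Aw t0 t0in).
set P := oriented_integral _ _ _ _ _ _ in P_prim.
pose mu theta := expR (P theta).
have dmu t (tin : lo < t < hi) :=
  is_stieltjes_derivative_expR J_incr J_cont tin (P_prim t tin).
have mugc : F_continuous A (fun theta => mu theta * g theta).
  apply/(F_continuous_param curve lo_ge hi_le AE) => t tin.
  apply: continuousM.
    exact: (stieltjes_derivative_continuous J_incr J_cont tin (dmu t tin)).
  exact: (F_continuous_param curve lo_ge hi_le AE g).1.
exists mu; split.
- move=> _ /AE [t tin <-]; eexists.
  by apply/(is_F_derivative_param curve lo_ge hi_le AE) => //; exact: dmu.
- by move=> theta _; rewrite gt_eqF// expR_gt0.
- by split=> // theta0 Atheta0; exact: integral.
- move=> I /(F_primitive_param curve lo_ge hi_le AE) I_prim y.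
  rewrite (is_solution_param curve lo_ge hi_le AE).
  rewrite (linear_equation_solutions (g := g \o w) J_incr J_cont (y \o w)
    P_prim I_prim).
  split=> -[c yE]; exists c; first by move=> _ /AE [t tin <-]; exact: yE.
  by move=> t /Aw /yE.
Unshelve. all: by end_near. Qed.
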